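(* Let $\theta\in\,]0,1[$ be fixed and, for $n\in\mathbb{N}$, let $m=\lfloor\theta n\rfloor$. Then $$\sup_{n\in\mathbb{N},\ \lfloor\theta n\rfloor\ge1}\Lambda_n^m<\infty,\qquad\text{where }\Lambda_n^m=\sup_{|x|\le1}\int_{-1}^1|s_n^m(x,y)|\,w(y)\,dy .$$
   Context: Let $w(x)=(1-x^2)^{-1/2}$ on $[-1,1]$ and $\langle f,g\rangle_{L^2_w}=\int_{-1}^1 fgw\,dx$. The orthonormal Chebyshev polynomials are $p_0=\sqrt{1/\pi}$ and $p_r(x)=\sqrt{2/\pi}\cos(r\arccos x)$, $r\ge1$. Chebyshev nodes: $x_k^n=\cos\frac{(2k-1)\pi}{2n}$, $k=1,\ldots,n$. For $0<m<n$: $\mu_{n,r}^m=1$ if $0\le r\le n-m$, $\mu_{n,r}^m=\frac{m+n-r}{2m}$ if $n-m<r<n+m$, $0$ otherwise; for $r=0,\ldots,n-1$, $q_{n,r}^m=p_r$ if $r\le n-m$ and $q_{n,r}^m=\mu_{n,r}^m p_r-\mu_{n,2n-r}^m p_{2n-r}$ if $n-m<r<n$; $\nu_{n,r}^m=1$ if $r\le n-m$ and $\nu_{n,r}^m=\frac{m^2+(n-r)^2}{2m^2}$ if $n-m<r<n$. The orthonormal VP scaling functions are $\tilde\varphi_{n,k}^m=\sum_{r=0}^{n-1}\sqrt{\frac{\pi}{n\nu_{n,r}^m}}p_r(x_k^n)q_{n,r}^m$, $k=1,\dots,n$, and the kernel of the corresponding orthogonal projection is $s_n^m(x,y)=\sum_{k=1}^n\tilde\varphi_{n,k}^m(x)\tilde\varphi_{n,k}^m(y)$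 (equivalently $\sum_{r=0}^{n-1}q_{n,r}^m(x)q_{n,r}^m(y)/\nu_{n,r}^m$). *)

(* Defs.v *)
From HB Require Import structures.
From mathcomp Require Import all_boot all_order all_algebra.
From mathcomp Require Import all_classical all_reals all_analysis.
Set Implicit Arguments. Unset Strict Implicit. Unset Printing Implicit Defensive.
Import Order.TTheory GRing.Theory Num.Theory.
Import numFieldNormedType.Exports.
Local Open Scope classical_set_scope.
Local Open Scope ring_scope.

Section Cheb.
Variable R : realType.

Definition cheb_w (x : R) : R := (Num.sqrt (1 - x ^+ 2))^-1.

Definition cheb_p (r : nat) (x : R) : R :=
  if r == 0%N then Num.sqrt (pi^-1)
  else Num.sqrt (2 / pi) * cos (r%:R * acos x).

Definition cheb_node (n k : nat) : R :=
  cos (((2 * k)%:R - 1) * pi / (2 * n)%:R).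

Definition vp_mu (n m r : nat) : R :=
  if (r <= n - m)%N then 1
  else if (r < n + m)%N then (m%:R + n%:R - r%:R) / (2 * m%:R)
  else 0.

Definition vp_q (n m r : nat) (x : R) : R :=
  if (r <= n - m)%N then cheb_p r x
  else vp_mu n m r * cheb_p r x - vp_mu n m (2 * n - r) * cheb_p (2 * n - r) x.

Definition vp_nu (n m r : nat) : R :=
  if (r <= n - m)%N then 1
  else (m%:R ^+ 2 + (n%:R - r%:R) ^+ 2) / (2 * m%:R ^+ 2).

Definition vp_phi (n m k : nat) (x : R) : R :=
  \sum_(0 <= r < n) Num.sqrt (pi / (n%:R * vp_nu n m r))
                     * cheb_p r (cheb_node n k) * vp_q n m r x.

Definition vp_kernel (n m : nat) (x y : R) : R :=
  \sum_(1 <= k < n.+1) vp_phi n m k x * vp_phi n m k y.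

Definition cheb_interval : set R := `[(-1 : R), 1]%classic.

Definition vp_lebesgue_const (n m : nat) : \bar R :=
  ereal_sup [set (\int[lebesgue_measure]_(y in cheb_interval)
                    (`|vp_kernel n m x y| * cheb_w y)%:E)%E
            | x in [set x : R | `|x| <= 1]].

End Cheb.

(* Main.v *)
(** In the variables [x = cos s], [y = cos t], discrete orthogonality of the
    [p_r] at the Chebyshev nodes gives [s_n^m = \sum_r q_r(x) q_r(y) / nu_r], and
    product-to-sum formulas turn [pi * s_n^m] into
      [(K_h(s-t) + K_h(s+t)) / 2
       - cos (n(s+t)) K_g(s-t) - cos (n(s-t)) K_g(s+t)],
    where [K_c(u) = c_0 + 2 \sum_(r > 0) c_r cos (r u)] and [h], [g] are rational
    functions of [(n - r) / m].  Two Abel summations write [K_c] as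
    [\sum_k (c_k - 2 c_(k+1) + c_(k+2)) F_k] with nonnegative Fejer kernels [F_k],
    and the integral of [F_k(s-t) + F_k(s+t)] against the Chebyshev weight is
    [2 pi (k+1)].  The second differences of [h] and [g] are [O(m^-2)] (except at
    the corner of [g], which contributes [O(1)]), so the Lebesgue constant is
    [O((n / m)^2)], which is bounded when [m] is the floor of [theta n]. *)

Require Import Defs.
From HB Require Import structures.
From mathcomp Require Import all_boot all_order all_algebra.
From mathcomp Require Import all_classical all_reals all_analysis.
From mathcomp Require Import measurable_realfun ring lra zify.
Import Order.TTheory GRing.Theory Num.Theory.
Import numFieldNormedType.Exports.
Local Open Scope classical_set_scope.
Local Open Scope ring_scope.

Set Implicit Arguments.
Unset Strict Implicit.

(** * Cosine sums, Fejer kernels and Abel summation *)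

Section CosineSums.
Variable R : realType.
Implicit Types (c : nat -> R) (N k : nat) (u s t : R).

(* [N] is the number of positive frequencies. *)
Definition cos_sum c N u : R := c 0%N + 2 * \sum_(r < N) c r.+1 * cos (r.+1%:R * u).

(* Unnormalized: the mean value of [fejer k] is [k.+1]. *)
Definition fejer k : R -> R := cos_sum (fun j => (k.+1 - j)%:R) k.

Definition diff2 c k : R := c k - 2 * c k.+1 + c k.+2.

Lemma cos_sumS c N u :
  cos_sum c N.+1 u = cos_sum c N u + 2 * c N.+1 * cos (N.+1%:R * u).
Proof. by rewrite /cos_sum big_ord_recr /=; ring. Qed.

(** With all coefficients equal to 1, [cos_sum] is the Dirichlet kernel, so the Fejer kernels are
    its partial sums. *)
Lemma fejerS k u : fejer k.+1 u = fejer k u + cos_sum (fun=> 1) k.+1 u.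
Proof.
rewrite /fejer !cos_sumS /cos_sum subSnn !subn0.
have -> : \sum_(r < k) (k.+2 - r.+1)%:R * cos (r.+1%:R * u) =
  \sum_(r < k) (k.+1 - r.+1)%:R * cos (r.+1%:R * u) +
  \sum_(r < k) 1 * cos (r.+1%:R * u) :> R.
  rewrite -big_split /=; apply: eq_bigr => i _.
  by rewrite !subSS subSn 1?ltnW // -natr1 mulrDl.
rewrite -[k.+2%:R]natr1; ring.
Qed.

(** The right-hand side is the squared modulus of the sum of the e^(iju), j <= k. In the induction,
    adding the unit vector e^(i(k+1)u) changes it by 1 plus twice a real inner product, which is the
    next Dirichlet kernel. *)
Lemma fejer_sqr k u : fejer k u =
  (\sum_(j < k.+1) cos (j%:R * u)) ^+ 2 + (\sum_(j < k.+1) sin (j%:R * u)) ^+ 2.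
Proof.
elim: k => [|k IH].
  by rewrite /fejer /cos_sum !big_ord1 big_ord0 /= mul0r cos0 sin0 subn0; ring.
rewrite fejerS IH [in RHS]big_ord_recr /= [X in _ = _ + X ^+ 2]big_ord_recr /=.
set C := \sum_(j < k.+1) _; set S := \sum_(j < k.+1) sin _.
set a := k.+1%:R * u.
have -> : cos_sum (fun=> 1) k.+1 u = 1 + 2 * (cos a * C + sin a * S).
  rewrite /cos_sum; congr (_ + 2 * _).
  (* Reversing the sum turns frequency [r.+1] into the difference of [k.+1] and [j], to which the
     subtraction formula for cosine applies. *)
  rewrite (reindex_inj rev_ord_inj) /= /C /S !mulr_sumr -big_split /=.
  apply: eq_bigr => j _; rewrite -cosB mul1r /a -mulrBl; congr (cos (_ * _)).
  by rewrite ?subSS -natrB ?(ltnW (ltn_ord j)) // subSn // -ltnS.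
have := cos2Dsin2 a; lra.
Qed.

Lemma fejer_ge0 k u : 0 <= fejer k u.
Proof. by rewrite fejer_sqr addr_ge0 // sqr_ge0. Qed.

(** Two summations by parts, the first producing Dirichlet kernels and the second Fejer kernels. The
    last two terms are the boundary contributions, which vanish once [c] is zero at [N.+1] and
    [N.+2]. *)
Lemma abel_fejer c N u : cos_sum c N u =
  \sum_(k < N.+1) diff2 c k * fejer k u
  + (c N.+1 - c N.+2) * fejer N u + c N.+1 * cos_sum (fun=> 1) N u.
Proof.
elim: N => [|N IH].
  by rewrite /fejer /cos_sum /diff2 big_ord1 !big_ord0 /= subn0; ring.
rewrite big_ord_recr /= fejerS !cos_sumS IH /diff2; ring.
Qed.

Lemma cos_sum_fejer_le c N u : c N.+1 = 0 -> c N.+2 = 0 ->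
  `|cos_sum c N u| <= \sum_(k < N.+1) `|diff2 c k| * fejer k u.
Proof.
move=> c1 c2; rewrite abel_fejer c1 c2 subr0 !mul0r !addr0.
apply: le_trans (ler_norm_sum _ _ _) _; apply: ler_sum => k _.
by rewrite normrM (ger0_norm (fejer_ge0 _ _)).
Qed.

Lemma cosM2 s t : 2 * (cos s * cos t) = cos (s - t) + cos (s + t).
Proof. by rewrite cosB cosD; ring. Qed.

Lemma cos_sum_sym c N s t : cos_sum c N (s - t) + cos_sum c N (s + t) =
  2 * (c 0%N + 2 * \sum_(r < N) c r.+1 * (cos (r.+1%:R * s) * cos (r.+1%:R * t))).
Proof.
rewrite /cos_sum mulrDr 2!mulr_sumr [in X in _ = _ + X]mulr_sumr mulr_sumr.
rewrite addrACA -big_split /=.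
congr (_ + _); first by ring.
apply: eq_bigr => r _.
have := cosM2 (r.+1%:R * s) (r.+1%:R * t); rewrite -mulrBr -mulrDr => E.
by rewrite -mulrDr -mulrDr -E; ring.
Qed.

(* The terms [cos ((n + j) s) cos ((n - j) t)], symmetrized in [j], are modulations
   of the frequency [n] by cosine sums of low frequency. *)
Lemma cos_sum_twist c N (n s t : R) :
  cos (n * (s + t)) * cos_sum c N (s - t) + cos (n * (s - t)) * cos_sum c N (s + t) =
  2 * (c 0%N * (cos (n * s) * cos (n * t)) + \sum_(j < N) c j.+1 *
     (cos ((n + j.+1%:R) * s) * cos ((n - j.+1%:R) * t) +
      cos ((n - j.+1%:R) * s) * cos ((n + j.+1%:R) * t))).
Proof.
rewrite /cos_sum; set A := cos (n * (s + t)); set B := cos (n * (s - t)).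
rewrite !mulrDr addrACA; congr (_ + _).
  have := cosM2 (n * s) (n * t).
  rewrite -mulrBr -mulrDr -/A -/B => E.
  by rewrite [RHS]mulrCA E; ring.
rewrite !mulr_sumr -big_split /=; apply: eq_bigr => j _.
set J := j.+1%:R.
rewrite [RHS]mulrCA [2 * (_ + _)]mulrDr !cosM2.
have -> : (n + J) * s - (n - J) * t = n * (s - t) + J * (s + t) by ring.
have -> : (n + J) * s + (n - J) * t = n * (s + t) + J * (s - t) by ring.
have -> : (n - J) * s - (n + J) * t = n * (s - t) - J * (s + t) by ring.
have -> : (n - J) * s + (n + J) * t = n * (s + t) - J * (s - t) by ring.
rewrite !(cosB (_ * _)) !(cosD (_ * _)) -/A -/B; ring.
Qed.
End CosineSums.

(** * Integration of cosine sums against the Chebyshev weight *)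

Section ChebyshevIntegral.
Variable R : realType.
Implicit Types (c : nat -> R) (N : nat).

Lemma sin_natpi (p : nat) : sin (p%:R * pi) = 0 :> R.
Proof.
by elim: p => [|p IH]; rewrite ?mul0r ?sin0 // -natr1 mulrDl mul1r sinDpi IH oppr0.
Qed.

Definition cos_sum_prim c N (t : R) : R :=
  c 0%N * t + 2 * \sum_(r < N) c r.+1 / r.+1%:R * sin (r.+1%:R * t).

Lemma is_derive_cos_sum_prim c N (t : R) :
  is_derive t (1 : R) (cos_sum_prim c N) (cos_sum c N t).
Proof.
elim: N => [|N IH].
  rewrite /cos_sum_prim /cos_sum.
  under eq_fun do rewrite big_ord0 mulr0 addr0.
  rewrite big_ord0 mulr0 addr0.
  have := is_deriveZ (c 0%N) (is_derive_id t (1 : R)).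
  by rewrite /GRing.scale /= mulr1.
rewrite cos_sumS.
have -> : cos_sum_prim c N.+1 = cos_sum_prim c N \+
    (fun t : R => (2 * (c N.+1 / N.+1%:R)) * sin (N.+1%:R * t)).
  by apply/funext => x; rewrite /cos_sum_prim big_ord_recr /=; ring.
apply: is_deriveD.
have N0 : N.+1%:R != 0 :> R by rewrite pnatr_eq0.
have D1 : is_derive t (1 : R) (fun t : R => N.+1%:R * t) N.+1%:R.
  have := is_deriveZ (N.+1%:R : R) (is_derive_id t (1 : R)).
  by rewrite /GRing.scale /= mulr1.
have D2 := is_derive1_comp (is_derive_sin (N.+1%:R * t)) D1.
have D3 := is_deriveZ (2 * (c N.+1 / N.+1%:R)) D2.
by apply: is_derive_eq; rewrite /GRing.scale /=; field.
Qed.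

Lemma is_derive_cos_sum_prim_acos c N (y : R) : -1 < y < 1 ->
  is_derive y (1 : R) (fun y => - cos_sum_prim c N (acos y))
    (cos_sum c N (acos y) * cheb_w y).
Proof.
move=> y1.
have := is_derive1_comp (is_derive_cos_sum_prim c N (acos y)) (is_derive1_acos y1).
move=> /is_deriveN D; apply: (is_derive_eq D).
by rewrite mulrN opprK /cheb_w.
Qed.

Lemma continuous_cheb_w (y : R) : -1 < y < 1 -> {for y, continuous (@cheb_w R)}.
Proof.
move=> y1; have y2 : 0 < 1 - y ^+ 2 by rewrite expr2; nra.
apply: continuousV; first by rewrite gt_eqF // sqrtr_gt0.
apply: (@continuous_comp _ _ _ (fun y : R => 1 - y ^+ 2) Num.sqrt).
  by apply: continuousB; [exact: cst_continuous | exact: exprn_continuous].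
exact: sqrt_continuous.
Qed.

Lemma continuous_cos_sum c N : continuous (cos_sum c N : R -> R).
Proof.
elim: N => [|N IH].
  have -> : cos_sum c 0 = cst (c 0%N) :> (R -> R).
    by apply/funext => t; rewrite /cos_sum big_ord0 mulr0 addr0.
  exact: cst_continuous.
have -> : cos_sum c N.+1 =
    (fun t => cos_sum c N t + 2 * c N.+1 * cos (N.+1%:R * t)) :> (R -> R).
  by apply/funext => t; rewrite cos_sumS.
move=> x; apply: continuousD; first exact: IH.
apply: continuousM; first exact: cst_continuous.
apply: (@continuous_comp _ _ _ (fun t : R => N.+1%:R * t) cos).
  exact: mulrl_continuous.
exact: continuous_cos.
Qed.

Lemma continuous_cos_sum_acos c N (y : R) : -1 < y < 1 ->
  {for y, continuous (fun y => cos_sum c N (acos y))}.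
Proof.
move=> y1; apply: (@continuous_comp _ _ _ acos (cos_sum c N)).
  exact: continuous_acos.
exact: continuous_cos_sum.
Qed.

Lemma continuous_cos_sum_cheb_w c N (y : R) : -1 < y < 1 ->
  {for y, continuous (fun y => cos_sum c N (acos y) * cheb_w y)}.
Proof.
move=> y1; apply: (@continuousM _ _ (fun y => cos_sum c N (acos y)) (@cheb_w R)).
  exact: continuous_cos_sum_acos.
exact: continuous_cheb_w.
Qed.

(** The substitution y = cos t, carried out by the fundamental theorem of calculus. The interval
    stays strictly inside ]-1, 1[ because [acos] is not differentiable at the endpoints. *)
Lemma integral_cheb_itv c N (a b : R) : -1 < a -> a < b -> b < 1 ->
  (\int[lebesgue_measure]_(y in `[a, b]) (cos_sum c N (acos y) * cheb_w y)%:E =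
   (cos_sum_prim c N (acos a) - cos_sum_prim c N (acos b))%:E)%E.
Proof.
move=> a1 ab b1.
have in1 y : y \in `[a, b] -> -1 < y < 1.
  by rewrite in_itv /= => /andP[ay yb]; rewrite (lt_le_trans a1) //= (le_lt_trans yb).
pose F y := - cos_sum_prim c N (acos y).
have dF y : y \in `[a, b] -> derivable F y 1.
  by move=> /in1 /(is_derive_cos_sum_prim_acos c N) [].
rewrite (@continuous_FTC2 _ _ F) //.
- by rewrite -EFinD; congr EFin; rewrite /F opprK addrC.
- apply: continuous_in_subspaceT => y; rewrite inE /= => /in1 y1.
  exact: continuous_cos_sum_cheb_w.
- have /(continuous_within_itvP _ ab)[_ ca cb] : {within `[a, b], continuous F}.
    by apply: derivable_within_continuous => y /dF.
  by split => // y yab; apply: dF; exact: subset_itv_oo_cc yab.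
- move=> y yab; rewrite derive1E.
  apply: derive_val; apply: is_derive_cos_sum_prim_acos.
  by apply: in1; exact: subset_itv_oo_cc yab.
Qed.

Lemma measurable_cheb_oo (f : R -> R) :
  (forall y : R, -1 < y < 1 -> {for y, continuous f}) ->
  measurable_fun `](-1 : R), 1[ f.
Proof.
move=> cf; apply: open_continuous_measurable_fun => //.
by move=> y; rewrite inE /= in_itv /=; exact: cf.
Qed.

Lemma integral_cheb_interval (f : R -> R) :
  (forall y : R, -1 < y < 1 -> {for y, continuous f}) ->
  (\int[lebesgue_measure]_(y in @cheb_interval R) (f y)%:E =
   \int[lebesgue_measure]_(y in `](-1 : R)%R, 1%R[) (f y)%:E)%E.
Proof.
move=> cf; have mf := measurable_cheb_oo cf.
rewrite /cheb_interval -integral_itv_obnd_cbnd; last first.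
  by apply/measurable_EFinP/measurable_fun_itv_bndo_bndcP.
by rewrite integral_itv_bndo_bndc //; apply/measurable_EFinP.
Qed.

Lemma cos_lt1 (e : R) : 0 < e <= 2^-1 -> cos e < 1.
Proof.
by move=> e0; have := pi_ge2 R => pi2; rewrite -cos0 ltr_cos ?in_itv /=; lra.
Qed.

Lemma acos_itv (e y : R) : 0 < e <= 2^-1 -> -1 < y < 1 ->
  e <= acos y <= pi - e -> - cos e <= y <= cos e.
Proof.
move=> e0 /andP[y1 y2] ae; have := pi_ge2 R => pi2.
have ca : cos (acos y) = y by rewrite acosK // in_itv /= !ltW.
have -> : - cos e = cos (pi - e) by rewrite cosB cospi sinpi; ring.
by rewrite -ca !leNgt !ltr_cos ?in_itv /=; lra.
Qed.

(** An exhaustion adapted to the substitution: [acos] maps the i-th interval onto [e, pi - e] with e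
    = 1/(i+2). The shift by 2 keeps e at most 1/2, below pi/2, so that no interval degenerates. *)
Lemma bigcup_cos_itv :
  \bigcup_i `[- cos (i.+2%:R^-1 : R), cos (i.+2%:R^-1)]%classic = `](-1 : R), 1[%classic.
Proof.
have ei i : 0 < (i.+2%:R^-1 : R) <= 2^-1.
  by rewrite invr_gt0 ltr0n /= lef_pV2 ?posrE ?ltr0n // ler_nat.
apply/seteqP; split => y /=.
  move=> [i _] /=; rewrite !in_itv /= => /andP[yl yr].
  by have := cos_lt1 (ei i); lra.
rewrite in_itv /= => y1; have /andP[y1l y1r] := y1.
have a0 : 0 < acos y by apply: acos_gt0; rewrite ltW.
have api : acos y < pi by apply: acos_ltpi; rewrite y1l ltW.
(* The distance from [acos y] to the ends of ]0, pi[; any i with 1/(i+2) <= e will do. *)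
pose e := Num.min (acos y) (pi - acos y).
have e0 : 0 < e by rewrite lt_min a0 subr_gt0.
exists (Num.truncn e^-1) => //=.
have ie : (Num.truncn e^-1).+2%:R^-1 <= e.
  rewrite -[leRHS]invrK lef_pV2 ?posrE ?ltr0n ?invr_gt0 //.
  apply: ltW; apply: lt_le_trans (truncnS_gt _) _.
  by rewrite ler_nat.
move: ie; rewrite le_min => /andP[ie1 ie2].
rewrite in_itv /=; apply: acos_itv => //.
by rewrite ie1 lerBrDr -lerBrDl.
Qed.

(** Nonnegativity allows monotone convergence along the exhaustion of ]-1, 1[. In the limit the
    primitive is evaluated at 0 and pi, where every sine vanishes, so only the constant coefficient
    survives. *)
Lemma integral_cheb c N : (forall t, 0 <= cos_sum c N t) ->
  (\int[lebesgue_measure]_(y in @cheb_interval R) (cos_sum c N (acos y) * cheb_w y)%:E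
   = (c 0%N * pi)%:E)%E.
Proof.
move=> c0.
have cf := @continuous_cos_sum_cheb_w c N.
rewrite integral_cheb_interval // -bigcup_cos_itv.
have pi2 := pi_ge2 R.
have ei i : 0 < (i.+2%:R^-1 : R) <= 2^-1.
  by rewrite invr_gt0 ltr0n /= lef_pV2 ?posrE ?ltr0n // ler_nat.
have mF := measurable_cheb_oo cf.
have cos1 i := cos_lt1 (ei i).
have cos_gt0 i : 0 < cos (i.+2%:R^-1 : R).
  by apply: cos_gt0_pihalf; have := ei i; move: (_^-1) => e h; lra.
have acosE i : acos (cos (i.+2%:R^-1)) = i.+2%:R^-1 :> R.
  by rewrite cosK // in_itv /=; have := ei i; move: (_^-1) => e h; lra.
have sub i : `[- cos (i.+2%:R^-1 : R), cos (i.+2%:R^-1)]%classic `<=` `](-1 : R), 1[.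
  by rewrite -bigcup_cos_itv => y yi; exists i.
have intE i : (\int[lebesgue_measure]_(y in `[(- cos (i.+2%:R^-1 : R))%R, cos (i.+2%:R^-1)%R])
    (cos_sum c N (acos y) * cheb_w y)%:E =
   (cos_sum_prim c N (pi - i.+2%:R^-1) - cos_sum_prim c N (i.+2%:R^-1))%:E)%E.
  have h1 := cos1 i; have h2 := cos_gt0 i.
  have h3 : -1 <= cos (i.+2%:R^-1 : R) <= 1 by lra.
  by rewrite integral_cheb_itv ?(acosN h3) ?acosE //; lra.
have e0 : (fun i => i.+2%:R^-1 : R) @ \oo --> (0 : R).
  by have := @cvg_harmonic R; rewrite -cvg_shiftS.
have prim_cont : continuous (cos_sum_prim c N).
  move=> x; apply: differentiable_continuous; apply/derivable1_diffP.
  by have [] := is_derive_cos_sum_prim c N x.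
have prim0 : cos_sum_prim c N 0 = 0.
  rewrite /cos_sum_prim big1 ?mulr0 ?addr0 // => r _.
  by rewrite mulr0 sin0 mulr0.
have primpi : cos_sum_prim c N pi = c 0%N * pi.
  rewrite /cos_sum_prim big1 ?mulr0 ?addr0 // => r _.
  by rewrite sin_natpi mulr0.
have lim1 : (fun i => (cos_sum_prim c N (pi - i.+2%:R^-1) - cos_sum_prim c N (i.+2%:R^-1))%:E)
    @ \oo --> (c 0%N * pi)%:E.
  apply: cvg_EFin; first exact: nearW.
  rewrite -primpi -[X in _ --> X]subr0 -[X in _ --> _ - X]prim0.
  apply: cvgB; last by apply: continuous_cvg => //; exact: prim_cont.
  apply: continuous_cvg; first exact: prim_cont.
  by rewrite -[X in _ --> X]subr0; apply: cvgB => //; exact: cvg_cst.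
(* The integrals over the exhausting intervals have the limit [c 0 * pi] by [lim1]; it remains to
   see that they also tend to the full integral. *)
apply: cvg_unique lim1; first exact: ereal_hausdorff.
have <- : (fun i => \int[lebesgue_measure]_(y in `[(- cos (i.+2%:R^-1 : R))%R, cos (i.+2%:R^-1)%R])
    (cos_sum c N (acos y) * cheb_w y)%:E)%E =
  (fun i => (cos_sum_prim c N (pi - i.+2%:R^-1) - cos_sum_prim c N (i.+2%:R^-1))%:E).
  by apply/funext => i; rewrite intE.
apply: ge0_nondecreasing_set_cvg_integral.
- move=> n m nm; rewrite subsetEset => y /=; rewrite !in_itv /= => /andP[yl yr].
  have mn : (m.+2%:R^-1 : R) <= n.+2%:R^-1.
    by rewrite lef_pV2 ?posrE ?ltr0n // ler_nat.
  have : cos (n.+2%:R^-1 : R) <= cos (m.+2%:R^-1).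
    have := ei n; have := ei m; move: mn.
    move: (m.+2%:R^-1) (n.+2%:R^-1) => a b ab a0 b0.
    by rewrite leNgt ltr_cos ?in_itv /=; lra.
  by lra.
- by move=> i; exact: measurable_itv.
- move=> i; apply/measurable_EFinP; apply: measurable_funS (sub i) mF.
  exact: measurable_itv.
- move=> i y _; rewrite lee_fin mulr_ge0 // /cheb_w invr_ge0; exact: sqrtr_ge0.
Qed.
End ChebyshevIntegral.

(** * Discrete orthogonality and the diagonal form of the kernel *)

Section Kernel.
Variable R : realType.
Implicit Types (n m r : nat) (x y : R).

Definition node_angle n k : R := ((2 * k)%:R - 1) * pi / (2 * n)%:R.

(** The angles [p * node_angle n k] advance by 2b with b = p pi / (2n), so multiplying by 2 sin b
    makes the sum telescope to sin (p pi) = 0. The range of [p] puts b in ]0, pi[, where sin b is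
    nonzero. *)
Lemma sum_cos_node n p : (0 < p < 2 * n)%N ->
  \sum_(1 <= k < n.+1) cos (p%:R * node_angle n k) = 0.
Proof.
move=> /andP[p0 pn].
have n0 : (2 * n)%:R != 0 :> R by rewrite pnatr_eq0; lia.
pose b : R := p%:R * pi / (2 * n)%:R.
have b0 : 0 < b < pi.
  have pi0 := pi_gt0 R.
  rewrite /b divr_gt0 ?mulr_gt0 ?ltr0n //=; last by lia.
  rewrite ltr_pdivrMr ?ltr0n; last by lia.
  by rewrite mulrC ltr_pM2l // ltr_nat.
have sb : 2 * sin b != 0 by rewrite mulf_neq0 ?pnatr_eq0 // gt_eqF // sin_gt0_pi.
apply: (mulfI sb); rewrite mulr0 mulr_sumr big_add1 /=.
rewrite (eq_bigr (fun k => sin ((2 * k.+1)%:R * b) - sin ((2 * k)%:R * b))); last first.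
  move=> k _.
  have -> : (2 * k.+1)%:R * b = p%:R * node_angle n k.+1 + b.
    by rewrite /node_angle /b; ring.
  have -> : (2 * k)%:R * b = p%:R * node_angle n k.+1 - b.
    by rewrite /node_angle /b mulnS natrD; ring.
  by rewrite sinD sinB; ring.
rewrite telescope_sumr // muln0 mul0r sin0 subr0.
have -> : (2 * n)%:R * b = p%:R * pi by rewrite /b mulrC divfK.
exact: sin_natpi.
Qed.

Definition cheb_coef r : R := if r == 0%N then Num.sqrt pi^-1 else Num.sqrt (2 / pi).

Lemma cheb_pE r x : cheb_p r x = cheb_coef r * cos (r%:R * acos x).
Proof. by rewrite /cheb_p /cheb_coef; case: eqP => // ->; rewrite mul0r cos0 mulr1. Qed.

Lemma cheb_coef_sqr r : cheb_coef r ^+ 2 = (if r == 0%N then 1 else 2) / pi.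
Proof.
have pi0 := pi_gt0 R; rewrite /cheb_coef; case: eqP => _.
  by rewrite sqr_sqrtr ?div1r // invr_ge0 ltW.
by rewrite sqr_sqrtr // divr_ge0 // ltW.
Qed.

Lemma cheb_p_node n k r : (0 < k <= n)%N ->
  cheb_p r (cheb_node R n k) = cheb_coef r * cos (r%:R * node_angle n k).
Proof.
move=> /andP[k0 kn]; rewrite cheb_pE /cheb_node cosK // in_itv /= -/(node_angle n k).
have pi0 := pi_gt0 R.
rewrite /node_angle divr_ge0 //=; last first.
  by rewrite mulr_ge0 ?(ltW pi0) // subr_ge0 ler1n; lia.
rewrite ler_pdivrMr ?ltr0n; last by lia.
rewrite mulrC ler_pM2l // lerBlDr natr1 ler_nat.
lia.
Qed.

(** Product-to-sum leaves the frequencies r - s and r + s, both below 2n, and only frequency 0 has a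
    nonzero sum over the nodes. *)
Lemma cheb_p_orthonormal n r s : (r < n)%N -> (s < n)%N ->
  \sum_(1 <= k < n.+1) cheb_p r (cheb_node R n k) * cheb_p s (cheb_node R n k) =
  if r == s then n%:R / pi else 0.
Proof.
wlog sr : r s / (s <= r)%N.
  move=> W rn sn; case: (leqP s r) => [sr|/ltnW rs]; first exact: W.
  by rewrite eq_sym -(W s r) //; apply: eq_bigr => k _; rewrite mulrC.
move=> rn sn; have pi0 := pi_gt0 R.
rewrite (eq_big_nat _ _ (F2 := fun k => cheb_coef r * cheb_coef s / 2 *
  (cos ((r - s)%:R * node_angle n k) + cos ((r + s)%:R * node_angle n k)))); last first.
  move=> k kn; rewrite !cheb_p_node //.
  rewrite natrB // natrD !(mulrBl, mulrDl).
  by rewrite -cosM2; field.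
rewrite -mulr_sumr big_split /=.
case: eqP => [rs|/eqP rs]; last first.
  by rewrite !sum_cos_node ?addr0 ?mulr0 //; lia.
rewrite -rs subnn -expr2 cheb_coef_sqr.
rewrite (eq_bigr (fun=> 1)); last by move=> k _; rewrite mul0r cos0.
rewrite sumr_const_nat subn1 /=.
(* For r = 0 both frequencies vanish, which doubles the sum and compensates the smaller
   normalization of [cheb_p 0]. *)
case: eqP => [->|r0].
  rewrite (eq_bigr (fun=> 1)); last by move=> k _; rewrite mul0r cos0.
  rewrite sumr_const_nat subn1 /=. by move: pi pi0 => p p0; field; rewrite gt_eqF.
rewrite sum_cos_node ?addr0; last by lia.
by move: pi pi0 => p p0; field; rewrite gt_eqF.
Qed.

Lemma vp_nu_gt0 n m r : (0 < m)%N -> 0 < vp_nu R n m r.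
Proof.
move=> m0; rewrite /vp_nu; case: ifP => _ //.
have m0' : 0 < m%:R :> R by rewrite ltr0n.
by rewrite divr_gt0 ?ltr_wpDr ?sqr_ge0 ?mulr_gt0 ?exprn_gt0.
Qed.

(** After expanding the product, the sum over the nodes kills the terms with r different from s; on
    the diagonal its value n / pi turns the squared weight pi / (n nu_r) into 1 / nu_r. *)
Lemma vp_kernel_diag n m x y : (0 < m < n)%N ->
  vp_kernel n m x y = \sum_(r < n) vp_q n m r x * vp_q n m r y / vp_nu R n m r.
Proof.
move=> /andP[m0 mn]; have pi0 := pi_gt0 R.
have n0 : 0 < n%:R :> R by rewrite ltr0n; lia.
rewrite /vp_kernel /vp_phi.
pose A r : R := Num.sqrt (pi / (n%:R * vp_nu R n m r)).
transitivity (\sum_(1 <= k < n.+1) \sum_(r < n) \sum_(s < n)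
   A r * A s * vp_q n m r x * vp_q n m s y *
   (cheb_p r (cheb_node R n k) * cheb_p s (cheb_node R n k))).
  apply: eq_bigr => k _; rewrite !big_mkord mulr_suml; apply: eq_bigr => r _.
  by rewrite mulr_sumr; apply: eq_bigr => s _; rewrite /A; ring.
rewrite exchange_big /=; apply: eq_bigr => r _.
rewrite exchange_big /= (bigD1 r) //= [X in _ + X]big1 ?addr0; last first.
  move=> s sr; rewrite -mulr_sumr cheb_p_orthonormal //.
  by rewrite ifN_eqC ?mulr0.
rewrite -mulr_sumr cheb_p_orthonormal // eqxx.
have nu0 := @vp_nu_gt0 n m r m0.
have -> : A r * A r = pi / (n%:R * vp_nu R n m r).
  by rewrite -expr2 sqr_sqrtr // divr_ge0 ?mulr_ge0 // ltW.
by move: pi pi0 => p p0; field; rewrite !gt_eqF.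
Qed.

(* For [n - m < r < n + m] this is [mu_r^2 / nu_r], with [nu] extended evenly around
   [n]; it equals 1 at [r = n - m] and 0 at [r = n + m]. *)
Definition vp_h n m r : R :=
  if (r <= n - m)%N then 1
  else if (r < n + m)%N then
    2^-1 + m%:R * (n%:R - r%:R) / (m%:R ^+ 2 + (n%:R - r%:R) ^+ 2)
  else 0.

(* [mu_(n-j) mu_(n+j) / nu_(n-j)] *)
Definition vp_g m j : R :=
  if (j < m)%N then (m%:R ^+ 2 - j%:R ^+ 2) / (2 * (m%:R ^+ 2 + j%:R ^+ 2)) else 0.

(** Expanding q_r(x) q_r(y) gives two squares, at the frequencies r and 2n - r mirrored about n, and
    a mixed term. For r <= n - m only the first square is present, in agreement with the zero values
    of [vp_h] and [vp_g] there. *)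
Lemma vp_term n m r x y : (0 < m < n)%N -> (0 < r < n)%N ->
  pi * (vp_q n m r x * vp_q n m r y / vp_nu R n m r) =
  2 * (vp_h n m r * (cos (r%:R * acos x) * cos (r%:R * acos y)) +
       vp_h n m (2 * n - r) *
         (cos ((2 * n - r)%:R * acos x) * cos ((2 * n - r)%:R * acos y)) -
       vp_g m (n - r) * (cos (r%:R * acos x) * cos ((2 * n - r)%:R * acos y) +
                         cos ((2 * n - r)%:R * acos x) * cos (r%:R * acos y))).
Proof.
move=> /andP[m0 mn] /andP[r0 rn]; have pi0 := pi_gt0 R.
have c2 : forall k, (0 < k)%N -> cheb_coef k = Num.sqrt (2 / pi) :> R.
  by move=> k; rewrite /cheb_coef; case: k.
have q2 : Num.sqrt (2 / pi) ^+ 2 = 2 / pi :> R by rewrite sqr_sqrtr // divr_ge0 // ltW.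
have m0' : 0 < m%:R :> R by rewrite ltr0n.
have r2 : (0 < 2 * n - r)%N by lia.
rewrite /vp_q /vp_nu /vp_h /vp_g !cheb_pE (c2 r) // (c2 _ r2).
set q := Num.sqrt _ in q2 *.
set X := cos _; set X' := cos _; set Y := cos _; set Y' := cos _.
case: (leqP r (n - m)) => rm.
  have -> : (2 * n - r <= n - m)%N = false by lia.
  have -> : (2 * n - r < n + m)%N = false by lia.
  have -> : (n - r < m)%N = false by lia.
  have -> : pi * (q * X * (q * Y) / 1) = pi * q ^+ 2 * (X * Y) by field.
  by rewrite q2; move: pi pi0 => p p0; field; rewrite gt_eqF.
rewrite /vp_mu leqNgt rm /=.
have -> : (r < n + m)%N by lia.
have -> : (2 * n - r <= n - m)%N = false by lia.
have -> : (2 * n - r < n + m)%N by lia.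
have -> : (n - r < m)%N by lia.
have -> : (2 * n - r)%:R = 2 * n%:R - r%:R :> R by rewrite natrB ?natrM //; lia.
have -> : (n - r)%:R = n%:R - r%:R :> R by rewrite natrB // ltnW.
set M := m%:R in m0' *; set j := n%:R - r%:R.
have -> : M + n%:R - r%:R = M + j by rewrite /j; ring.
have -> : M + n%:R - (2 * n%:R - r%:R) = M - j by rewrite /j; ring.
have -> : n%:R - (2 * n%:R - r%:R) = - j by rewrite /j; ring.
have D0 : 0 < M ^+ 2 + j ^+ 2 by rewrite ltr_wpDr ?sqr_ge0 ?exprn_gt0.
clearbody X X' Y Y' j M.
transitivity (pi * q ^+ 2 * ((((M + j) / (2 * M)) * X - (M - j) / (2 * M) * X') *
  (((M + j) / (2 * M)) * Y - (M - j) / (2 * M) * Y')) / ((M ^+ 2 + j ^+ 2) / (2 * M ^+ 2))).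
  by ring.
rewrite q2; clear q2; move: pi pi0 => p p0; field.
by rewrite !gt_eqF // sqrrN.
Qed.
End Kernel.

(** * Second differences of the two coefficient sequences *)

Section SecondDifferences.
Variable R : realType.
Implicit Types (n m k : nat) (M i j : R).

Lemma ler_norm_div_sqr (X D C M : R) : 0 < M -> 0 < D -> `|X| * M ^+ 2 <= C * D ->
  `|X / D| <= C / M ^+ 2.
Proof.
move=> M0 D0 H; rewrite normrM normfV (gtr0_norm D0) ler_pdivrMr //.
by rewrite mulrAC ler_pdivlMr // exprn_gt0.
Qed.

(** Over the common denominator B Bp Bm, the numerator is at most 2 M^2 times 4 B; then B cancels
    and Bp Bm >= M^4. *)
Lemma diff2_ramp M i : 1 <= M -> `|i| <= M ->
  `|M * (i + 1) / (M ^+ 2 + (i + 1) ^+ 2) - 2 * (M * i / (M ^+ 2 + i ^+ 2))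
    + M * (i - 1) / (M ^+ 2 + (i - 1) ^+ 2)| <= 8 / M ^+ 2.
Proof.
move=> M1 iM; have M0 : 0 < M by lra.
set B := M ^+ 2 + i ^+ 2; set Bp := M ^+ 2 + (i + 1) ^+ 2; set Bm := M ^+ 2 + (i - 1) ^+ 2.
have M20 : 1 <= M ^+ 2 by rewrite expr_ge1 // ltW.
have BM : M ^+ 2 <= B by rewrite lerDl sqr_ge0.
have BpM : M ^+ 2 <= Bp by rewrite lerDl sqr_ge0.
have BmM : M ^+ 2 <= Bm by rewrite lerDl sqr_ge0.
have [B0 Bp0 Bm0] : [/\ 0 < B, 0 < Bp & 0 < Bm] by split; lra.
have -> : M * (i + 1) / Bp - 2 * (M * i / B) + M * (i - 1) / Bm =
    (M * i * 2 * (4 * i ^+ 2 - 3 * B - 1)) / (B * (Bp * Bm)).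
  rewrite /B /Bp /Bm in B0 Bp0 Bm0 *; field.
  by rewrite !gt_eqF.
apply: ler_norm_div_sqr; rewrite ?mulr_gt0 //.
have h1 : `|4 * i ^+ 2 - 3 * B - 1| <= 4 * B.
  have i2 : 0 <= i ^+ 2 by exact: sqr_ge0.
  by rewrite ler_norml; apply/andP; split; rewrite /B in BM *; lra.
have h2 : `|M * i * 2| <= 2 * M ^+ 2.
  rewrite !normrM (gtr0_norm M0) (@ger0_norm _ 2) // mulrC ler_pM2l // expr2.
  by rewrite ler_pM2l.
have h3 : M ^+ 2 * M ^+ 2 <= Bp * Bm by rewrite ler_pM // sqr_ge0.
rewrite normrM.
apply: (@le_trans _ _ (2 * M ^+ 2 * (4 * B) * M ^+ 2)).
  by rewrite ler_wpM2r ?sqr_ge0 // ler_pM.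
have -> : 2 * M ^+ 2 * (4 * B) * M ^+ 2 = 8 * B * (M ^+ 2 * M ^+ 2) by ring.
by rewrite [leRHS]mulrA ler_wpM2l //; lra.
Qed.

(** The function M i / (M^2 + i^2) has zero slope at its extrema i = M and i = -M, so [vp_h] meets
    its constant pieces to first order and even a first difference at a joint is O(M^-2). *)
Lemma ramp_last M : 1 <= M ->
  `|2^-1 - M * (M - 1) / (M ^+ 2 + (M - 1) ^+ 2)| <= 8 / M ^+ 2.
Proof.
move=> M1; have M0 : 0 < M ^+ 2 by rewrite exprn_gt0; lra.
have D0 : 0 < M ^+ 2 + (M - 1) ^+ 2 by rewrite ltr_wpDr ?sqr_ge0.
have -> : 2^-1 - M * (M - 1) / (M ^+ 2 + (M - 1) ^+ 2) =
    2^-1 / (M ^+ 2 + (M - 1) ^+ 2) by field; rewrite gt_eqF.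
apply: ler_norm_div_sqr => //; first by lra.
rewrite ger0_norm ?invr_ge0 //; have := sqr_ge0 (M - 1); lra.
Qed.

(** The middle formula also holds at both joints n - m and n + m. Hence only the triples centred at
    a joint mix two formulas, and [ramp_last] treats those. *)
Lemma diff2_vp_h n m k : (0 < m < n)%N -> `|diff2 (vp_h R n m) k| <= 8 / m%:R ^+ 2.
Proof.
move=> /andP[m0 mn]; have M1 : 1 <= m%:R :> R by rewrite ler1n.
have M2 : 0 < m%:R ^+ 2 :> R by rewrite exprn_gt0 // ltr0n.
have C0 : 0 <= 8 / m%:R ^+ 2 :> R by rewrite divr_ge0 // ltW.
have hmid r : (n - m <= r <= n + m)%N -> vp_h R n m r =
    2^-1 + m%:R * (n%:R - r%:R) / (m%:R ^+ 2 + (n%:R - r%:R) ^+ 2).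
  move=> /andP[r1 r2]; rewrite /vp_h; case: (leqP r (n - m)) => r3.
    have -> : r = (n - m)%N by lia.
    have -> : n%:R - (n - m)%:R = m%:R :> R by rewrite natrB ?(ltnW mn) //; ring.
    by field; rewrite gt_eqF ?addr_gt0.
  case: ltnP => // r4; have -> : r = (n + m)%N by lia.
  have -> : n%:R - (n + m)%:R = - m%:R :> R by rewrite natrD; ring.
  by field; rewrite sqrrN gt_eqF ?addr_gt0.
have hlo r : (r <= n - m)%N -> vp_h R n m r = 1 by rewrite /vp_h => ->.
have hhi r : (n + m <= r)%N -> vp_h R n m r = 0.
  by move=> rnm; rewrite /vp_h !ifF //; lia.
rewrite /diff2.
case: (leqP k.+2 (n - m)) => k1.
  rewrite (hlo k) ?(hlo k.+1) ?(hlo k.+2); [|lia..].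
  have -> : 1 - 2 * 1 + 1 = 0 :> R by ring.
  by rewrite normr0.
case: (leqP k.+1 (n - m)) => k2.
  have nE : n%:R = m%:R + k.+1%:R :> R by rewrite -natrD; congr (_%:R); lia.
  rewrite (hlo k) ?(hlo k.+1) ?(hmid k.+2); [|lia..].
  have -> : n%:R - k.+2%:R = m%:R - 1 :> R by rewrite nE -[k.+2%:R]natr1; ring.
  have := ramp_last M1; rewrite -normrN; congr (`|_| <= _).
  by set X := _ * _ / _; lra.
case: (leqP (n + m) k) => k3.
  rewrite (hhi k) ?(hhi k.+1) ?(hhi k.+2); [|lia..].
  by rewrite mulr0 subr0 addr0 normr0.
case: (leqP (n + m) k.+1) => k4.
  rewrite (hhi k.+1) ?(hhi k.+2) ?(hmid k); [|lia..].
  have kE : k%:R = n%:R + m%:R - 1 :> R.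
    by rewrite -natrD (_ : (n + m)%N = k.+1); [rewrite -natr1 addrK | lia].
  have -> : n%:R - k%:R = 1 - m%:R :> R by rewrite kE; ring.
  have := ramp_last M1; congr (`|_| <= _).
  by rewrite -(opprB m%:R 1) sqrrN; ring.
rewrite (hmid k) ?(hmid k.+1) ?(hmid k.+2); [|lia..].
have iM : `|n%:R - k.+1%:R| <= m%:R :> R.
  rewrite ler_norml; apply/andP; split.
    by rewrite lerBrDr addrC lerBlDr -natrD ler_nat; lia.
  by rewrite lerBlDr -natrD ler_nat; lia.
have := diff2_ramp M1 iM.
have -> : n%:R - k%:R = n%:R - k.+1%:R + 1 :> R by rewrite -natr1; ring.
have -> : n%:R - k.+2%:R = n%:R - k.+1%:R - 1 :> R by rewrite -[k.+2%:R]natr1; ring.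
by congr (`|_| <= _); ring.
Qed.

(** The constant is 10 = 2 + 8: the numerator is M^2 times a factor bounded by 2 A0 + 8 A1, and in
    each summand the two remaining denominators are at least M^2. *)
Lemma diff2_bump M j : 1 <= M -> 0 <= j ->
  `|(M ^+ 2 - j ^+ 2) / (2 * (M ^+ 2 + j ^+ 2))
    - 2 * ((M ^+ 2 - (j + 1) ^+ 2) / (2 * (M ^+ 2 + (j + 1) ^+ 2)))
    + (M ^+ 2 - (j + 2) ^+ 2) / (2 * (M ^+ 2 + (j + 2) ^+ 2))| <= 10 / M ^+ 2.
Proof.
move=> M1 j0.
have M20 : 1 <= M ^+ 2 by rewrite expr_ge1 //; lra.
set A0 := M ^+ 2 + j ^+ 2; set A1 := M ^+ 2 + (j + 1) ^+ 2; set A2 := M ^+ 2 + (j + 2) ^+ 2.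
have A0M : M ^+ 2 <= A0 by rewrite lerDl sqr_ge0.
have A1M : M ^+ 2 <= A1 by rewrite lerDl sqr_ge0.
have A2M : M ^+ 2 <= A2 by rewrite lerDl sqr_ge0.
have [A00 A10 A20] : [/\ 0 < A0, 0 < A1 & 0 < A2] by split; lra.
have -> : (M ^+ 2 - j ^+ 2) / (2 * A0) - 2 * ((M ^+ 2 - (j + 1) ^+ 2) / (2 * A1))
    + (M ^+ 2 - (j + 2) ^+ 2) / (2 * A2) =
    (M ^+ 2 * ((2 * j + 1) * (4 * j + 4) - 2 * A0)) / (A0 * (A1 * A2)).
  rewrite /A0 /A1 /A2 in A00 A10 A20 *; field.
  by rewrite !gt_eqF.
apply: ler_norm_div_sqr; rewrite ?mulr_gt0 //; first by lra.
have h1 : `|(2 * j + 1) * (4 * j + 4) - 2 * A0| <= 2 * A0 + 8 * A1.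
  rewrite ler_norml /A1 /A0 in A0M *; nra.
rewrite normrM (@ger0_norm _ (M ^+ 2)); last by lra.
have h2 : M ^+ 2 * M ^+ 2 * A0 <= A1 * A2 * A0.
  by rewrite ler_wpM2r ?ler_pM //; lra.
have h3 : M ^+ 2 * M ^+ 2 * A1 <= A0 * A2 * A1.
  by rewrite ler_wpM2r ?ler_pM //; lra.
have h4 : M ^+ 2 * M ^+ 2 * `|(2 * j + 1) * (4 * j + 4) - 2 * A0| <=
    M ^+ 2 * M ^+ 2 * (2 * A0 + 8 * A1) by rewrite ler_wpM2l // mulr_ge0; lra.
by move: h2 h3 h4; clear; lra.
Qed.

(* [vp_g] has a corner at [j = m], hence the exceptional term. *)
Lemma diff2_vp_g m k : (0 < m)%N ->
  k.+1%:R * `|diff2 (vp_g R m) k| <= k.+1%:R * (10 / m%:R ^+ 2) + (k.+1 == m)%:R.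
Proof.
move=> m0; have M1 : 1 <= m%:R :> R by rewrite ler1n.
have M2 : 0 < m%:R ^+ 2 :> R by rewrite exprn_gt0 // ltr0n.
have C0 : 0 <= 10 / m%:R ^+ 2 :> R by rewrite divr_ge0 // ltW.
have glo r : (r <= m)%N -> vp_g R m r =
    (m%:R ^+ 2 - r%:R ^+ 2) / (2 * (m%:R ^+ 2 + r%:R ^+ 2)).
  rewrite /vp_g; case: ltnP => // mr rm.
  by rewrite (_ : r = m) ?subrr ?mul0r //; lia.
have ghi r : (m <= r)%N -> vp_g R m r = 0 by rewrite /vp_g ltnNge => ->.
rewrite /diff2.
case: (ltngtP k.+1 m) => km.
- rewrite addr0 ler_wpM2l // (glo k) ?(glo k.+1) ?(glo k.+2); [|lia..].
  have := diff2_bump M1 (ler0n R k).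
  by rewrite natr1 -(addn2 k) natrD.
- rewrite (ghi k) ?(ghi k.+1) ?(ghi k.+2); [|lia..].
  by rewrite mulr0 subr0 addr0 normr0 mulr0 addr0 mulr_ge0.
(* At the corner the second difference is just [vp_g R m k], which is only O(1/m); the factor
   [k.+1], equal to m, brings it to at most 1. *)
- subst m; rewrite (ghi k.+1) ?(ghi k.+2) ?(glo k); [|lia..].
  rewrite mulr0 subr0 addr0; apply: ler_wpDl; first by rewrite mulr_ge0.
  rewrite -natr1; have x0 : 0 <= k%:R :> R by [].
  move: (k%:R : R) x0 => x x0.
  have D0 : 0 < 2 * ((x + 1) ^+ 2 + x ^+ 2) by nra.
  rewrite ger0_norm; last by rewrite divr_ge0 ?(ltW D0) //; nra.
  by rewrite mulrA ler_pdivrMr // mul1r; nra.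
Qed.

End SecondDifferences.

(** * Fejer majorant of the kernel and bound of the Lebesgue constant *)

Section LebesgueConstant.
Variable R : realType.
Implicit Types (n m : nat) (x y : R).

(** The frequencies 1, ..., 2n - 1 of [vp_h] are split into those below n, n itself and those above
    n; [vp_term] supplies r and its mirror image 2n - r together. *)
Lemma vp_kernel_cos_sum n m x y : (0 < m < n)%N ->
  let s := acos x in let t := acos y in
  pi * vp_kernel n m x y =
    2^-1 * (cos_sum (vp_h R n m) (2 * n).-1 (s - t) + cos_sum (vp_h R n m) (2 * n).-1 (s + t))
    - (cos (n%:R * (s + t)) * cos_sum (vp_g R m) n.-1 (s - t) +
       cos (n%:R * (s - t)) * cos_sum (vp_g R m) n.-1 (s + t)).
Proof.
move=> mn s t; rewrite vp_kernel_diag // cos_sum_sym cos_sum_twist.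
case: n mn => [|n] mn; first by lia.
have n1 : (n < n.+1)%N by [].
rewrite [(2 * n.+1).-1](_ : _ = n + (1 + n))%N; last by lia.
rewrite big_ord_recl mulrDr big_split_ord big_split_ord big_ord1 /= addn0.
(* Frequency [n] is absent from the kernel; here its two contributions cancel since
   [vp_h n m n = vp_g m 0 = 1/2]. *)
set hn := vp_h _ _ _ n.+1; have -> : hn = 2^-1.
  rewrite /hn /vp_h ifF; last by lia.
  by rewrite ifT ?subrr ?mulr0 ?mul0r ?addr0 //; lia.
have h0 : vp_h R n.+1 m 0 = 1 by [].
have g0 : vp_g R m 0 = 2^-1.
  rewrite /vp_g; have /andP[-> _] := mn.
  have m0 : 0 < m%:R :> R by rewrite ltr0n; lia.
  by rewrite expr0n subr0 addr0; field; rewrite gt_eqF.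
have T0 : pi * (vp_q n.+1 m 0 x * vp_q n.+1 m 0 y / vp_nu R n.+1 m 0) = 1.
  rewrite /vp_q /vp_nu /= !cheb_pE divr1 !mul0r !cos0 !mulr1 -expr2 cheb_coef_sqr /=.
  by rewrite mulrCA mulrV ?mulr1 // unitfE gt_eqF // pi_gt0.
rewrite T0 h0 g0 mulr_sumr.
pose cc (a b : nat) := cos (a%:R * s) * cos (b%:R * t) : R.
rewrite (eq_bigr (fun r : 'I_n => 2 * (vp_h R n.+1 m r.+1 * cc r.+1 r.+1) +
   2 * (vp_h R n.+1 m (2 * n.+1 - r.+1) * cc (2 * n.+1 - r.+1)%N (2 * n.+1 - r.+1)%N) -
   2 * (vp_g R m (n.+1 - r.+1) * (cc r.+1 (2 * n.+1 - r.+1)%N + cc (2 * n.+1 - r.+1)%N r.+1))));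
  last first.
  move=> r _; rewrite /bump /= add1n vp_term //; last by have := ltn_ord r; lia.
  by rewrite /cc; ring.
rewrite sumrB big_split /= -!mulr_sumr.
(* Reversal makes [j.+1] the distance to the central frequency, as in [cos_sum_twist]. *)
rewrite (reindex_inj rev_ord_inj (P := xpredT)
  (F := fun r : 'I_n => vp_h R n.+1 m (2 * n.+1 - r.+1) * cc (2 * n.+1 - r.+1)%N (2 * n.+1 - r.+1)%N)) /=.
rewrite (reindex_inj rev_ord_inj (P := xpredT)
  (F := fun r : 'I_n => vp_g R m (n.+1 - r.+1) * (cc r.+1 (2 * n.+1 - r.+1)%N + cc (2 * n.+1 - r.+1)%N r.+1))) /=.
rewrite [X in _ + 2 * X - _](eq_bigr (fun j : 'I_n => vp_h R n.+1 m (n + (1 + j)).+1 *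
   (cos ((n + (1 + j)).+1%:R * s) * cos ((n + (1 + j)).+1%:R * t)))); last first.
  move=> j _; have := ltn_ord j => jn.
  by rewrite (_ : (2 * n.+1 - (n - j.+1).+1 = (n + (1 + j)).+1)%N) //; lia.
rewrite [X in _ + (_ - 2 * X) = _](eq_bigr (fun j : 'I_n => vp_g R m j.+1 *
     (cos ((n.+1%:R + j.+1%:R) * s) * cos ((n.+1%:R - j.+1%:R) * t) +
      cos ((n.+1%:R - j.+1%:R) * s) * cos ((n.+1%:R + j.+1%:R) * t)))); last first.
  move=> j _; have := ltn_ord j => jn.
  rewrite (_ : (n.+1 - (n - j.+1).+1 = j.+1)%N); last by lia.
  rewrite (_ : (2 * n.+1 - (n - j.+1).+1 = n.+1 + j.+1)%N); last by lia.
  rewrite (_ : ((n - j.+1).+1 = n.+1 - j.+1)%N); last by lia.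
  rewrite /cc natrD natrB; last by lia.
  by congr (_ * _); exact: addrC.
set A := \sum_(i < n) _; set B := \sum_(i < n) _; set C := \sum_(i < n) _.
set D := cos _ * cos _; rewrite -/A; lra.
Qed.

Lemma cos_sum_widen (c : nat -> R) N M u : (N <= M)%N ->
  (forall j, (N < j)%N -> c j = 0) -> cos_sum c M u = cos_sum c N u.
Proof.
move=> NM c0; elim: M NM => [|M IH]; first by rewrite leqn0 => /eqP ->.
rewrite leq_eqVlt => /predU1P[-> //|NM].
by rewrite cos_sumS IH // c0 // mulr0 mul0r addr0.
Qed.

(** The coefficients in [t], with [s] frozen, of a combination of symmetrized Fejer translates.
    Truncated subtraction in [k.+1 - j] removes the frequencies above [k], so one length serves all
    the kernels. *)
Definition translate_coef (e : nat -> R) K (s : R) j : R :=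
  \sum_(k < K) e k * (2 * ((k.+1 - j)%:R * cos (j%:R * s))).

Lemma sum_fejer_translate (e : nat -> R) K (s t : R) :
  \sum_(k < K) e k * (fejer k (s - t) + fejer k (s + t)) =
  cos_sum (translate_coef e K s) K t.
Proof.
rewrite /cos_sum /translate_coef.
rewrite [X in _ + 2 * X](eq_bigr _ (fun r _ => mulr_suml _ _ _ _)).
rewrite exchange_big /= mulr_sumr -big_split /=; apply: eq_bigr => k _.
have fE (u : R) : fejer k u = cos_sum (fun j => (k.+1 - j)%:R) K u.
  rewrite (@cos_sum_widen _ k) // ?(ltnW (ltn_ord k)) //.
  by move=> j kj; rewrite (_ : (k.+1 - j = 0)%N) //; lia.
rewrite !fE cos_sum_sym mul0r cos0 mulr1 !mulrDr; congr (_ + _).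
rewrite !mulr_sumr; apply: eq_bigr => j _; ring.
Qed.

(** The majorant is a nonnegative cosine sum in [acos y], so its integral is pi times its constant
    coefficient, which does not depend on [s]. *)
Lemma integral_fejer_majorant (f : R -> R) (e : nat -> R) K (s : R) :
  (forall y, -1 < y < 1 -> {for y, continuous f}) ->
  (forall k, 0 <= e k) ->
  (forall y, `|f y| <= \sum_(k < K) e k * (fejer k (s - acos y) + fejer k (s + acos y))) ->
  (\int[lebesgue_measure]_(y in @cheb_interval R) (`|f y| * cheb_w y)%:E
    <= (2 * pi * \sum_(k < K) e k * k.+1%:R)%:E)%E.
Proof.
move=> cf e0 fle.
have w0 y : 0 <= cheb_w y :> R by rewrite /cheb_w invr_ge0 sqrtr_ge0.
have cfw y : -1 < y < 1 -> {for y, continuous (fun y => `|f y| * cheb_w y)}.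
  move=> y1; apply: (@continuousM _ _ (fun y => `|f y|) (@cheb_w R)).
    by apply: (@continuous_comp _ _ _ f (fun z : R => `|z|)); [exact: cf | exact: norm_continuous].
  exact: continuous_cheb_w.
pose c := translate_coef e K s.
have ccw := @continuous_cos_sum_cheb_w R c K.
have c0 t : 0 <= cos_sum c K t.
  rewrite -sum_fejer_translate; apply: sumr_ge0 => k _.
  by rewrite mulr_ge0 // addr_ge0 // fejer_ge0.
have -> : 2 * pi * \sum_(k < K) e k * k.+1%:R = c 0%N * pi.
  rewrite mulrAC mulr_sumr; congr (_ * _); apply: eq_bigr => k _.
  by rewrite mul0r cos0 subn0; ring.
rewrite -(integral_cheb (N := K)) // !integral_cheb_interval //.
apply: ge0_le_integral => //.
- by move=> y _; rewrite lee_fin mulr_ge0.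
- by apply/measurable_EFinP; exact: measurable_cheb_oo.
- by apply/measurable_EFinP; exact: measurable_cheb_oo.
- move=> y _; rewrite lee_fin ler_wpM2r // (le_trans (fle y)) //.
  by rewrite sum_fejer_translate.
Qed.

Lemma continuous_sum_at (I : Type) (r : seq I) (F : I -> R -> R) y :
  (forall i, {for y, continuous (F i)}) ->
  {for y, continuous (fun y => \sum_(i <- r) F i y)}.
Proof.
move=> cF; elim: r => [|i r IH].
  rewrite (_ : (fun y => _) = cst 0); first exact: cst_continuous.
  by apply/funext => z; rewrite big_nil.
rewrite (_ : (fun y => _) = (fun y => F i y + \sum_(j <- r) F j y)).
  exact: (continuousD (cF i) IH).
by apply/funext => z; rewrite big_cons.
Qed.

Lemma continuous_cheb_p r y : -1 < y < 1 -> {for y, continuous (@cheb_p R r)}.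
Proof.
move=> y1; rewrite (_ : @cheb_p R r = fun y => cheb_coef R r * cos (r%:R * acos y)); last first.
  by apply/funext => z; rewrite cheb_pE.
apply: (@continuousM _ _ (cst (cheb_coef R r)) (fun y => cos (r%:R * acos y))).
  exact: cst_continuous.
apply: (@continuous_comp _ _ _ (fun y => r%:R * acos y) cos); last exact: continuous_cos.
apply: (@continuousM _ _ (cst r%:R) acos); first exact: cst_continuous.
exact: continuous_acos.
Qed.

Lemma continuous_vp_kernel n m x y : -1 < y < 1 -> {for y, continuous (vp_kernel n m x)}.
Proof.
move=> y1; apply: continuous_sum_at => k.
apply: (@continuousM _ _ (cst (vp_phi n m k x)) (vp_phi n m k)); first exact: cst_continuous.
apply: continuous_sum_at => r.
apply: (@continuousM _ _
  (cst (Num.sqrt (pi / (n%:R * vp_nu R n m r)) * cheb_p r (cheb_node R n k)))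
  (vp_q n m r)); first exact: cst_continuous.
have cc (a : R) i : {for y, continuous (fun y => a * cheb_p i y)}.
  apply: (@continuousM _ _ (cst a) (cheb_p i)); first exact: cst_continuous.
  exact: continuous_cheb_p.
case E : (r <= n - m)%N.
  rewrite (_ : vp_q n m r = cheb_p r); first exact: continuous_cheb_p.
  by apply/funext => z; rewrite /vp_q E.
rewrite (_ : vp_q n m r = fun y => vp_mu R n m r * cheb_p r y -
  vp_mu R n m (2 * n - r) * cheb_p (2 * n - r) y).
  exact: (continuousB (cc _ _) (cc _ _)).
by apply/funext => z; rewrite /vp_q E.
Qed.

(** The modulating cosines have modulus at most 1. Both coefficient sequences vanish from 2n on, as
    m < n, so the boundary terms of the Abel summation disappear. *)
Lemma vp_kernel_le n m x y : (0 < m < n)%N ->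
  `|pi * vp_kernel n m x y| <= \sum_(k < 2 * n)
     (2^-1 * `|diff2 (vp_h R n m) k| + `|diff2 (vp_g R m) k|) *
       (fejer k (acos x - acos y) + fejer k (acos x + acos y)).
Proof.
move=> mn; rewrite vp_kernel_cos_sum //=.
set s := acos x; set t := acos y.
have n2 : (2 * n = (2 * n).-1.+1)%N by lia.
have hb u : `|cos_sum (vp_h R n m) (2 * n).-1 u| <= \sum_(k < 2 * n) `|diff2 (vp_h R n m) k| * fejer k u.
  rewrite [in leRHS]n2; apply: cos_sum_fejer_le; rewrite /vp_h !ifF //; lia.
have g0 j : (m <= j)%N -> vp_g R m j = 0 by rewrite /vp_g ltnNge => ->.
have gb u : `|cos_sum (vp_g R m) n.-1 u| <= \sum_(k < 2 * n) `|diff2 (vp_g R m) k| * fejer k u.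
  rewrite -(@cos_sum_widen _ _ (2 * n).-1); [|lia| by move=> j nj; rewrite g0 //; lia].
  by rewrite [in leRHS]n2; apply: cos_sum_fejer_le; rewrite g0 //; lia.
have cb (a u : R) : `|cos a * cos_sum (vp_g R m) n.-1 u| <= `|cos_sum (vp_g R m) n.-1 u|.
  by rewrite normrM ler_piMl // ler_norml cos_geN1 cos_le1.
have E : \sum_(k < 2 * n)
     (2^-1 * `|diff2 (vp_h R n m) k| + `|diff2 (vp_g R m) k|) * (fejer k (s - t) + fejer k (s + t)) =
   2^-1 * (\sum_(k < 2 * n) `|diff2 (vp_h R n m) k| * fejer k (s - t) +
           \sum_(k < 2 * n) `|diff2 (vp_h R n m) k| * fejer k (s + t)) +
   (\sum_(k < 2 * n) `|diff2 (vp_g R m) k| * fejer k (s - t) +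
    \sum_(k < 2 * n) `|diff2 (vp_g R m) k| * fejer k (s + t)).
  rewrite -!big_split /= mulr_sumr -big_split /=; apply: eq_bigr => k _; ring.
rewrite E.
apply: le_trans (ler_normB _ _) _; apply: lerD.
  rewrite normrM (@ger0_norm _ 2^-1) // ler_wpM2l //.
  by apply: le_trans (ler_normD _ _) _; exact: lerD (hb _) (hb _).
apply: le_trans (ler_normD _ _) _; apply: lerD.
  exact: le_trans (cb _ _) (gb _).
exact: le_trans (cb _ _) (gb _).
Qed.

Lemma vp_lebesgue_const_le n m : (0 < m < n)%N ->
  (vp_lebesgue_const R n m <= (112 * (n%:R / m%:R) ^+ 2 + 2)%:E)%E.
Proof.
move=> mn; have pi0 := pi_gt0 R.
have /andP[m0 _] := mn.
apply: ge_ereal_sup => _ [x _ <-].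
pose e k : R := pi^-1 * (2^-1 * `|diff2 (vp_h R n m) k| + `|diff2 (vp_g R m) k|).
have e0 k : 0 <= e k by rewrite mulr_ge0 ?invr_ge0 ?(ltW pi0) // addr_ge0 // mulr_ge0.
apply: le_trans (@integral_fejer_majorant (vp_kernel n m x) e (2 * n) (acos x) _ e0 _) _.
- by move=> y; exact: continuous_vp_kernel.
- move=> y; have := vp_kernel_le x y mn.
  rewrite normrM (gtr0_norm pi0) mulrC -ler_pdivlMr // => /le_trans; apply.
  rewrite mulrC mulr_sumr le_eqVlt; apply/predU1P; left; apply: eq_bigr => k _; rewrite /e; ring.
rewrite lee_fin.
have C0 : 0 <= (m%:R ^+ 2)^-1 :> R by rewrite invr_ge0 sqr_ge0.
have kb (k : 'I_(2 * n)) : k.+1%:R <= 2 * n%:R :> R by rewrite -natrM ler_nat.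
have -> : 2 * pi * \sum_(k < 2 * n) e k * k.+1%:R =
    \sum_(k < 2 * n) (k.+1%:R * `|diff2 (vp_h R n m) k| + 2 * (k.+1%:R * `|diff2 (vp_g R m) k|)).
  rewrite mulr_sumr; apply: eq_bigr => k _; rewrite /e.
  move: pi pi0 => p p0; field; rewrite gt_eqF //.
(* With k + 1 <= 2n, each term is at most 2n (8 + 2 * 10) / m^2 = 56 n / m^2, plus 2 at the corner
   of [vp_g]; summing 2n terms gives 112 (n / m)^2 + 2. *)
apply: (@le_trans _ _ (\sum_(k < 2 * n) (56 * n%:R / m%:R ^+ 2 + 2 * (k.+1 == m)%:R))).
  apply: ler_sum => k _.
  have h1 := diff2_vp_h R k mn.
  have h2 := diff2_vp_g R k m0.
  have h3 : k.+1%:R * `|diff2 (vp_h R n m) k| <= 2 * n%:R * (8 / m%:R ^+ 2).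
    by rewrite ler_pM.
  have h4 : k.+1%:R * (10 / m%:R ^+ 2) <= 2 * n%:R * (10 / m%:R ^+ 2) :> R.
    by rewrite ler_wpM2r // mulr_ge0.
  by lra.
rewrite big_split /= sumr_const card_ord -mulr_sumr.
have -> : \sum_(k < 2 * n) (k.+1 == m)%:R = 1 :> R.
  have mo : (m.-1 < 2 * n)%N by lia.
  rewrite (bigD1 (Ordinal mo)) //= prednK // eqxx big1 ?addr0 // => k.
  rewrite -val_eqE /= => km; rewrite (_ : (k.+1 == m) = false) //; lia.
rewrite mulr1 lerD2r -[leLHS]mulr_natr natrM.
by rewrite expr_div_n le_eqVlt; apply/predU1P; left; ring.
Qed.

End LebesgueConstant.

(** * Uniform bound when m is the floor of theta n *)

Unset Implicit Arguments.
Set Strict Implicit.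

Theorem theorem1 (R : realType) (theta : R) (htheta : 0 < theta < 1) :
  exists M : R, forall n m : nat,
    m%:Z = Num.floor (theta * n%:R) -> (1 <= m)%N ->
    (vp_lebesgue_const R n m <= M%:E)%E.
Proof.
have /andP[t0 t1] := htheta.
(* Since theta n < m + 1 <= 2m, the ratio n / m is at most 2 / theta. *)
exists (112 * (2 / theta) ^+ 2 + 2) => n m mE m1.
have m1' : 1 <= m%:R :> R by rewrite ler1n.
have lo : m%:R <= theta * n%:R.
  have := Num.Theory.floor_le (theta * n%:R); by rewrite -mE.
have hi : theta * n%:R < m%:R + 1.
  have := floorD1_gt (theta * n%:R); by rewrite -mE intrD.
have n0 : 0 < n%:R :> R.
  rewrite ltr0n lt0n; apply/eqP => n0; move: lo; rewrite n0 mulr0; lra.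
have mn : (0 < m < n)%N.
  by rewrite m1 -(ltr_nat R) (le_lt_trans lo) // gtr_pMl.
apply: le_trans (vp_lebesgue_const_le _ mn) _.
rewrite lee_fin lerD2r ler_pM2l // ler_sqr ?nnegrE ?divr_ge0 ?(ltW t0) //.
rewrite ler_pdivrMr ?ltr0n // mulrAC ler_pdivlMr //; lra.
Qed.
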